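(* For every integer $k\ge0$, the function $\Xi_1^{[k]}$ satisfies on $0\le x<1$ the second-order differential equation $$ \left[x^2(1-x^2)\frac{d^2}{dx^2}+x(1-3x^2)\frac{d}{dx}+x^2(k^2-1)-k^2\right]\Xi_1^{[k]}(x)=0 . $$
   Context: For an integer $k\ge 0$ and $0\le x<1$ the rank-1 function is defined by $$ \Xi_1^{[k]}(x):=\frac12\int_0^{\pi}\frac{\cos(k\theta)}{\sqrt{1+x^2-2x\cos\theta}}\,d\theta . $$ Derivatives at $x=0$ are understood as one-sided derivatives. *)

(* Defs.v *)
From Stdlib Require Export Reals.
From Coquelicot Require Export Coquelicot.
Open Scope R_scope.

Definition Xi1 (k : nat) (x : R) : R :=
  / 2 * RInt (fun theta => cos (INR k * theta)
                           / sqrt (1 + x ^ 2 - 2 * x * cos theta)) 0 PI.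

Definition I01 (x : R) : Prop := 0 <= x < 1.

(* [D_in f d I01 x] takes the limit of the difference quotient only through
   points of I01, so it is the ordinary derivative at 0 < x < 1 and the right
   derivative at x = 0. Values of f, f', f'' outside I01 play no role, and
   f', f'' are uniquely determined by f on I01. *)
Definition twice_derivable_with (f f' f'' : R -> R) : Prop :=
  forall x : R, I01 x -> D_in f f' I01 x /\ D_in f' f'' I01 x.

(* Main.v *)
Require Import Defs.
From Stdlib Require Import Reals Lra.
From Coquelicot Require Import Coquelicot.
Open Scope R_scope.

(** Put [u = D^(-1/2)] with [D = 1 + x^2 - 2 x cos t], the reciprocal of the
    distance between two points of the plane.  Since the planar Laplacian of
    [1/r] is [1/r^3], one finds
    [x^2 (1 - x^2) u_xx + x (1 - 3 x^2) u_x - x^2 u + (1 - x^2) u_tt = 0].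
    Because [k^2 cos (k t)] is minus the second derivative of [cos (k t)], the
    differential operator applied under the integral sign yields [1 - x^2]
    times the [t]-derivative of the Wronskian [(cos (k t))' u - cos (k t) u_t],
    which vanishes at [0] and at [PI]. *)

(** * Squared distance: positivity and joint continuity *)

Definition dist2 (x t : R) : R := 1 + x ^ 2 - 2 * x * cos t.

(** [dist2 x t] equals both [(1 - x)^2 + 2 x (1 - cos t)] and [(1 + x)^2 - 2 x (1 + cos t)]; the
    sign of [x] decides which form has nonnegative summands. *)
Lemma dist2_pos (x t : R) : Rabs x < 1 -> 0 < dist2 x t.
Proof.
  intros [H1 H2]%Rabs_def2.
  unfold dist2.
  pose proof (COS_bound t) as [H3 H4].
  destruct (Rle_or_lt 0 x) as [H0|H0].
  - assert (0 <= x * (1 - cos t)) by (apply Rmult_le_pos; lra).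
    assert (0 < (1 - x) * (1 - x)) by (apply Rmult_lt_0_compat; lra).
    nra.
  - assert (0 <= - x * (1 + cos t)) by (apply Rmult_le_pos; lra).
    assert (0 < (1 + x) * (1 + x)) by (apply Rmult_lt_0_compat; lra).
    nra.
Qed.

Lemma continuity_2d_pt_dist2 (x t : R) : continuity_2d_pt dist2 x t.
Proof.
  unfold dist2.
  apply continuity_2d_pt_minus.
  - apply (continuity_1d_2d_pt_comp (fun y => 1 + y ^ 2) (fun u _ => u)).
    + reg.
    + apply continuity_2d_pt_id1.
  - apply continuity_2d_pt_mult.
    + apply (continuity_1d_2d_pt_comp (fun y => 2 * y) (fun u _ => u)).
      * reg.
      * apply continuity_2d_pt_id1.
    + apply (continuity_1d_2d_pt_comp cos (fun _ v => v)).
      * reg.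
      * apply continuity_2d_pt_id2.
Qed.

Lemma continuity_2d_pt_inv_dist_pow (n : nat) (x t : R) :
  Rabs x < 1 -> continuity_2d_pt (fun y v => / sqrt (dist2 y v) ^ n) x t.
Proof.
  intros Hx.
  pose proof (dist2_pos x t Hx) as HD.
  apply continuity_2d_pt_inv.
  - apply (continuity_1d_2d_pt_comp (fun z => sqrt z ^ n) dist2).
    + apply (continuity_pt_comp sqrt (fun z => z ^ n)).
      * apply continuity_pt_sqrt; lra.
      * apply derivable_continuous_pt, derivable_pt_pow.
    + apply continuity_2d_pt_dist2.
  - apply pow_nonzero, Rgt_not_eq, sqrt_lt_R0, HD.
Qed.

Lemma continuity_2d_pt_x_minus_cos (x t : R) :
  continuity_2d_pt (fun y v => y - cos v) x t.
Proof.
  apply continuity_2d_pt_minus.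
  - apply continuity_2d_pt_id1.
  - apply (continuity_1d_2d_pt_comp cos (fun _ v => v)).
    + reg.
    + apply continuity_2d_pt_id2.
Qed.

Lemma continuity_2d_pt_cos_mul (c x t : R) :
  continuity_2d_pt (fun _ v => cos (c * v)) x t.
Proof.
  apply (continuity_1d_2d_pt_comp (fun v => cos (c * v)) (fun _ v => v)).
  - reg.
  - apply continuity_2d_pt_id2.
Qed.

(** * Integrals depending on a parameter *)

Lemma continuity_2d_pt_continuous_snd (f : R -> R -> R) (x t : R) :
  continuity_2d_pt f x t -> continuous (f x) t.
Proof.
  intros Hf.
  apply continuity_pt_filterlim.
  intros eps Heps.
  destruct (Hf (mkposreal eps Heps)) as [d Hd].
  exists d; split; [apply cond_pos|].
  intros v [_ Hv].
  apply Hd; [|exact Hv].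
  rewrite Rminus_diag, Rabs_R0; apply cond_pos.
Qed.

(** The set [Rabs y < 1] is open, so the hypotheses hold on a neighbourhood of [x], as
    differentiation under the integral sign requires. It serves for [kern] and then for [kern_x]. *)
Lemma is_derive_RInt_param_unit (f f' : R -> R -> R) (a b x : R) :
  (forall y t, Rabs y < 1 -> continuity_2d_pt f y t) ->
  (forall y t, Rabs y < 1 -> continuity_2d_pt f' y t) ->
  (forall y t, Rabs y < 1 -> is_derive (fun z => f z t) y (f' y t)) ->
  Rabs x < 1 ->
  is_derive (fun y => RInt (f y) a b) x (RInt (f' x) a b).
Proof.
  intros Cf Cf' Hd Hx.
  assert (Hloc : locally x (fun y => Rabs y < 1)).
  { assert (H0 : 0 < 1 - Rabs x) by lra.
    exists (mkposreal _ H0); intros y Hy.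
    change (Rabs (y - x) < 1 - Rabs x) in Hy.
    pose proof (Rabs_triang_inv y x).
    lra. }
  (* [is_derive_RInt_param] states its result with [Derive], hence the change of integrand. *)
  rewrite (RInt_ext (f' x) (fun t => Derive (fun u => f u t) x)).
  2:{ intros t _; symmetry; apply is_derive_unique, Hd, Hx. }
  apply is_derive_RInt_param.
  - revert Hloc; apply filter_imp; intros y Hy t _.
    eexists; apply Hd, Hy.
  - intros t _.
    apply continuity_2d_pt_ext_loc with f'; [|apply Cf', Hx].
    destruct Hloc as [d Hloc].
    exists d; intros u v Hu _.
    symmetry; apply is_derive_unique, Hd, Hloc, Hu.
  - revert Hloc; apply filter_imp; intros y Hy.
    apply (ex_RInt_continuous (V := R_CompleteNormedModule)); intros t _.
    apply continuity_2d_pt_continuous_snd, Cf, Hy.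
Qed.

(** * The integrand and its first two derivatives in [x] *)

(** The exponent [1] keeps the shape covered by [continuity_2d_pt_inv_dist_pow]. *)
Definition kern (k : nat) (x t : R) : R :=
  cos (INR k * t) * / sqrt (dist2 x t) ^ 1.

Definition kern_x (k : nat) (x t : R) : R :=
  - (cos (INR k * t) * (x - cos t) * / sqrt (dist2 x t) ^ 3).

Definition kern_xx (k : nat) (x t : R) : R :=
  cos (INR k * t)
  * (3 * ((x - cos t) * (x - cos t)) * / sqrt (dist2 x t) ^ 5
     - / sqrt (dist2 x t) ^ 3).

Lemma continuity_2d_pt_kern (k : nat) (x t : R) :
  Rabs x < 1 -> continuity_2d_pt (kern k) x t.
Proof.
  intros Hx.
  apply continuity_2d_pt_mult;
    [apply continuity_2d_pt_cos_mul | now apply continuity_2d_pt_inv_dist_pow].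
Qed.

Lemma continuity_2d_pt_kern_x (k : nat) (x t : R) :
  Rabs x < 1 -> continuity_2d_pt (kern_x k) x t.
Proof.
  intros Hx.
  apply continuity_2d_pt_opp, continuity_2d_pt_mult;
    [apply continuity_2d_pt_mult | now apply continuity_2d_pt_inv_dist_pow].
  - apply continuity_2d_pt_cos_mul.
  - apply continuity_2d_pt_x_minus_cos.
Qed.

Lemma continuity_2d_pt_kern_xx (k : nat) (x t : R) :
  Rabs x < 1 -> continuity_2d_pt (kern_xx k) x t.
Proof.
  intros Hx.
  apply continuity_2d_pt_mult; [apply continuity_2d_pt_cos_mul|].
  apply continuity_2d_pt_minus; [|now apply continuity_2d_pt_inv_dist_pow].
  apply continuity_2d_pt_mult; [|now apply continuity_2d_pt_inv_dist_pow].
  apply continuity_2d_pt_mult; [apply continuity_2d_pt_const|].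
  apply continuity_2d_pt_mult; apply continuity_2d_pt_x_minus_cos.
Qed.

Lemma is_derive_kern (k : nat) (x t : R) :
  Rabs x < 1 -> is_derive (fun y => kern k y t) x (kern_x k x t).
Proof.
  intros Hx.
  pose proof (dist2_pos x t Hx) as HD.
  pose proof (sqrt_lt_R0 _ HD) as Hs.
  unfold kern, kern_x, dist2 in *.
  auto_derive.
  - split; [exact HD|]; split; [|exact I].
    apply (pow_nonzero _ 1), Rgt_not_eq, Hs.
  - replace (1 + x * (x * 1) + - (2 * x * cos t)) with (1 + x ^ 2 - 2 * x * cos t)
      by ring.
    field; lra.
Qed.

Lemma is_derive_kern_x (k : nat) (x t : R) :
  Rabs x < 1 -> is_derive (fun y => kern_x k y t) x (kern_xx k x t).
Proof.
  intros Hx.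
  pose proof (dist2_pos x t Hx) as HD.
  pose proof (sqrt_lt_R0 _ HD) as Hs.
  unfold kern_x, kern_xx, dist2 in *.
  auto_derive.
  - split; [exact HD|]; split; [|exact I].
    apply (pow_nonzero _ 3), Rgt_not_eq, Hs.
  - replace (1 + x * (x * 1) + - (2 * x * cos t)) with (1 + x ^ 2 - 2 * x * cos t)
      by ring.
    field; lra.
Qed.

(** * The Wronskian as an antiderivative in [t] *)

(** Since [u_t = - x sin t / sqrt (dist2 x t) ^ 3], the second summand is [- cos (k t) u_t]. *)
Definition kern_wronskian (k : nat) (x t : R) : R :=
  - INR k * sin (INR k * t) * / sqrt (dist2 x t)
  + cos (INR k * t) * x * sin t * / sqrt (dist2 x t) ^ 3.

Definition ode_operator (k : nat) (x y'' y' y : R) : R :=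
  x ^ 2 * (1 - x ^ 2) * y'' + x * (1 - 3 * x ^ 2) * y'
  + (x ^ 2 * (INR k ^ 2 - 1) - INR k ^ 2) * y.

(** The products of first derivatives cancel, leaving [(1 - x^2) cos (k t) (- k^2 u - u_tt)]. The
    equation for [u] trades [u_tt] for derivatives in [x], and [x^2 (k^2 - 1) - k^2 = - x^2 - (1 -
    x^2) k^2]. *)
Lemma is_derive_kern_wronskian (k : nat) (x t : R) :
  Rabs x < 1 ->
  is_derive (fun v => (1 - x ^ 2) * kern_wronskian k x v) t
    (ode_operator k x (kern_xx k x t) (kern_x k x t) (kern k x t)).
Proof.
  intros Hx.
  pose proof (dist2_pos x t Hx) as HD.
  pose proof (sqrt_lt_R0 _ HD) as Hs.
  pose proof (pow2_sqrt _ (Rlt_le _ _ HD)) as Hs2.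
  pose proof (sin2_cos2 t) as Hsc.
  unfold Rsqr in Hsc.
  unfold ode_operator, kern_wronskian, kern, kern_x, kern_xx, dist2 in *.
  auto_derive.
  - repeat split; try exact HD.
    + apply Rgt_not_eq, Hs.
    + apply (pow_nonzero _ 3), Rgt_not_eq, Hs.
  - replace (1 + x * (x * 1) + - (2 * x * cos t)) with (1 + x ^ 2 - 2 * x * cos t)
      by ring.
    set (s := sqrt _) in *.
    set (c := cos t) in *.
    set (C := cos (INR k * t)) in *.
    set (d := sin t) in *.
    (* This is the derivative after cancellation, with [u_tt] written out. So far [s], [c], [d] are
       independent atoms; [d^2 = 1 - c^2] and [s^2 = 1 + x^2 - 2 x c] enter afterwards. *)
    transitivity ((1 - x ^ 2) * C * (- INR k ^ 2 * / s + x * c * / s ^ 3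
                    - 3 * x ^ 2 * (d * d) * / s ^ 5)).
    + field; lra.
    + replace (d * d) with (1 - c * c) by lra.
      (* Both sides become homogeneous of degree [-5] in [s]. *)
      replace (/ s ^ 3) with ((1 + x ^ 2 - 2 * x * c) * / s ^ 5)
        by (rewrite <- Hs2; field; lra).
      replace (/ s) with ((1 + x ^ 2 - 2 * x * c) ^ 2 * / s ^ 5)
        by (rewrite <- Hs2; field; lra).
      replace (/ s ^ 1) with ((1 + x ^ 2 - 2 * x * c) ^ 2 * / s ^ 5)
        by (rewrite <- Hs2; field; lra).
      ring.
Qed.

Lemma kern_wronskian_0 (k : nat) (x : R) : kern_wronskian k x 0 = 0.
Proof.
  unfold kern_wronskian.
  rewrite Rmult_0_r, sin_0; ring.
Qed.

(** The integrality of [k] enters here, removing the boundary term at [PI]. *)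
Lemma sin_INR_PI (k : nat) : sin (INR k * PI) = 0.
Proof.
  apply sin_eq_0_1; exists (Z.of_nat k); now rewrite INR_IZR_INZ.
Qed.

Lemma kern_wronskian_PI (k : nat) (x : R) : kern_wronskian k x PI = 0.
Proof.
  unfold kern_wronskian.
  rewrite sin_INR_PI, sin_PI; ring.
Qed.

(** A two-sided limit survives when only points of [D] may approach [x]; for [I01] at [0] this gives
    the right derivative. *)
Lemma is_derive_D_in (f f' : R -> R) (D : R -> Prop) (x : R) :
  is_derive f x (f' x) -> D_in f f' D x.
Proof.
  intros Hf%is_derive_Reals%derivable_pt_lim_D_in.
  intros eps Heps.
  destruct (Hf eps Heps) as [d [Hd H]].
  exists d; split; [exact Hd|].
  intros y [[_ Hy] Hyd].
  apply H; repeat split; assumption.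
Qed.

(** * The differential equation for the integral *)

Lemma continuous_ode_operator_kern (k : nat) (x t : R) :
  Rabs x < 1 ->
  continuous
    (fun v => ode_operator k x (kern_xx k x v) (kern_x k x v) (kern k x v)) t.
Proof.
  intros Hx.
  unfold ode_operator.
  apply @continuous_plus; [apply @continuous_plus|];
    apply @continuous_scal_r, continuity_2d_pt_continuous_snd.
  - now apply continuity_2d_pt_kern_xx.
  - now apply continuity_2d_pt_kern_x.
  - now apply continuity_2d_pt_kern.
Qed.

(** The operator applied to the integrand is integrated in two ways: by linearity, and by the
    fundamental theorem of calculus from the boundary values of the Wronskian. *)
Lemma ode_operator_RInt_kern (k : nat) (x : R) :
  Rabs x < 1 ->
  ode_operator k x (RInt (kern_xx k x) 0 PI) (RInt (kern_x k x) 0 PI)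
    (RInt (kern k x) 0 PI) = 0.
Proof.
  intros Hx.
  assert (Hex : forall g : R -> R -> R,
    (forall t, continuity_2d_pt g x t) -> is_RInt (g x) 0 PI (RInt (g x) 0 PI)).
  { intros g Hg.
    apply (RInt_correct (V := R_CompleteNormedModule)).
    apply (ex_RInt_continuous (V := R_CompleteNormedModule)); intros t _.
    apply continuity_2d_pt_continuous_snd, Hg. }
  pose proof (Hex _ (fun t => continuity_2d_pt_kern k x t Hx)) as I0.
  pose proof (Hex _ (fun t => continuity_2d_pt_kern_x k x t Hx)) as I1.
  pose proof (Hex _ (fun t => continuity_2d_pt_kern_xx k x t Hx)) as I2.
  pose proof (is_RInt_plus _ _ _ _ _ _
    (is_RInt_plus _ _ _ _ _ _
      (is_RInt_scal _ _ _ (x ^ 2 * (1 - x ^ 2)) _ I2)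
      (is_RInt_scal _ _ _ (x * (1 - 3 * x ^ 2)) _ I1))
    (is_RInt_scal _ _ _ (x ^ 2 * (INR k ^ 2 - 1) - INR k ^ 2) _ I0)) as Hlin.
  assert (Hftc : is_RInt (fun t =>
    ode_operator k x (kern_xx k x t) (kern_x k x t) (kern k x t)) 0 PI 0).
  (* The first [0] is the lower limit of integration; the second, replaced here, is the value of the
     integral. *)
  { replace 0 with (minus ((1 - x ^ 2) * kern_wronskian k x PI)
                          ((1 - x ^ 2) * kern_wronskian k x 0)) at 2.
    2:{ rewrite kern_wronskian_0, kern_wronskian_PI.
        unfold minus, plus, opp; simpl; ring. }
    apply (is_RInt_derive (V := R_CompleteNormedModule)
             (fun t => (1 - x ^ 2) * kern_wronskian k x t)).
    - intros t _; now apply is_derive_kern_wronskian.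
    - intros t _; now apply continuous_ode_operator_kern. }
  transitivity (RInt (fun t =>
    ode_operator k x (kern_xx k x t) (kern_x k x t) (kern k x t)) 0 PI).
  (* [Hlin] has the required form once [ode_operator], [plus] and [scal] are unfolded by
     conversion. *)
  - symmetry; apply is_RInt_unique, Hlin.
  - apply is_RInt_unique, Hftc.
Qed.

Lemma Xi1_kern (k : nat) (x : R) : Xi1 k x = / 2 * RInt (kern k x) 0 PI.
Proof.
  unfold Xi1; f_equal.
  apply RInt_ext; intros t _.
  unfold kern, dist2; now rewrite pow_1.
Qed.

Theorem corollary1 :
  forall k : nat,
  exists f' f'' : R -> R,
    twice_derivable_with (Xi1 k) f' f'' /\
    forall x : R, 0 <= x < 1 ->
      x ^ 2 * (1 - x ^ 2) * f'' x
      + x * (1 - 3 * x ^ 2) * f' x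
      + (x ^ 2 * (INR k ^ 2 - 1) - INR k ^ 2) * Xi1 k x = 0.
Proof.
  intros k.
  exists (fun x => / 2 * RInt (kern_x k x) 0 PI),
    (fun x => / 2 * RInt (kern_xx k x) 0 PI).
  split.
  - intros x Hx01.
    (* In [Rabs x < 1] the endpoint [0] is interior, so two-sided differentiation covers it as
       well. *)
    assert (Hx : Rabs x < 1) by (unfold I01 in Hx01; apply Rabs_def1; lra).
    split; apply is_derive_D_in.
    + apply (is_derive_ext (fun y => / 2 * RInt (kern k y) 0 PI));
        [intros y; symmetry; apply Xi1_kern|].
      apply is_derive_scal, is_derive_RInt_param_unit; auto using
        continuity_2d_pt_kern, continuity_2d_pt_kern_x, is_derive_kern.
    + apply is_derive_scal, is_derive_RInt_param_unit; auto using
        continuity_2d_pt_kern_x, continuity_2d_pt_kern_xx, is_derive_kern_x.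
  - intros x Hx01.
    assert (Hx : Rabs x < 1) by (apply Rabs_def1; lra).
    pose proof (ode_operator_RInt_kern k x Hx) as H.
    unfold ode_operator in H.
    rewrite Xi1_kern.
    (* The operator is linear, so the factor [/ 2] of [Xi1] passes through it. *)
    apply (Rmult_eq_compat_l (/ 2)) in H.
    rewrite Rmult_0_r in H.
    etransitivity; [|exact H]; ring.
Qed.
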